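(* Let $p$ be a prime and let $A\subseteq\mathcal{B}_{(1)}(\mathbb{Q}_p(\mathbb{N}))$ be a norm-closed subalgebra containing $\mathcal{K}_{(1)}(\mathbb{Q}_p(\mathbb{N}))$. If $E$ is an idempotent element of the quotient algebra $A/\mathcal{K}_{(1)}(\mathbb{Q}_p(\mathbb{N}))$, then there exists $e\in A$ with $e^2=e$ and $e+\mathcal{K}_{(1)}(\mathbb{Q}_p(\mathbb{N}))=E$.
   Context: $\mathbb{Q}_p(\mathbb{N})$ is the set of maps $\xi:\mathbb{N}\to\mathbb{Q}_p$ with $|\xi(i)|_p\le 1$ for all but finitely many $i$, a $\mathbb{Z}_p$-module under coordinatewise operations, with the topology $\tau$ in which $A\subseteq\mathbb{Q}_p(\mathbb{N})$ is open iff for every finite $P\subseteq\mathbb{N}$ the set $A\cap\big(\prod_{i\in P}\mathbb{Q}_p\times\prod_{j\notin P}\mathbb{Z}_p\big)$ is open in the product topology. $\mathcal{B}(\mathbb{Q}_p(\mathbb{N}))$ is the algebra of $\tau$-continuous $\mathbb{Z}_p$-linear maps on $\mathbb{Q}_p(\mathbb{N})$. Norm: $\|\xi\|=\max_i|\xi(i)|_p$; operator norm $\|T\|=\sup_{\|\xi\|\le1}\|T\xi\|$. $\mathcal{B}_{(1)}(\mathbb{Q}_p(\mathbb{N}))$ is the set of operators of norm at most $1$. $\mathcal{K}(\mathbb{Q}_p(\mathbb{N}))$ is the set of operators in $\mathcal{B}(\mathbb{Q}_p(\mathbb{N}))$ mapping norm-bounded sets onto relatively $\tau$-compact sets, and $\mathcal{K}_{(1)}(\mathbb{Q}_p(\mathbb{N}))$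 those of norm at most $1$. *)

(* Defs.v *)
From mathcomp Require Import all_boot all_order all_algebra.
From Stdlib Require List.
From mathcomp Require Import boolp classical_sets reals.
Set Implicit Arguments. Unset Strict Implicit. Unset Printing Implicit Defensive.
Import Order.TTheory GRing.Theory Num.Theory.
Local Open Scope ring_scope.
Local Open Scope classical_set_scope.

(* Any such (K, absv) is isometrically isomorphic to (Q_p, |.|_p).     *)
Record is_Qp (p : nat) (R : realType) (K : fieldType) (absv : K -> R) : Prop := {
  Qp_abs_ge0 : forall x, 0 <= absv x;
  Qp_abs_eq0 : forall x, absv x = 0 <-> x = 0;
  Qp_absM : forall x y, absv (x * y) = absv x * absv y;
  Qp_abs_ultra : forall x y, absv (x + y) <= Num.max (absv x) (absv y);
  Qp_abs_p : absv (p%:R) = (p%:R)^-1;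
  Qp_abs_coprime : forall n : nat, coprime n p -> absv (n%:R) = 1;
  Qp_complete : forall u : nat -> K,
    (forall e : R, 0 < e -> exists N : nat, forall m n : nat,
        (N <= m)%N -> (N <= n)%N -> absv (u m - u n) < e) ->
    exists l : K, forall e : R, 0 < e -> exists N : nat, forall n : nat,
        (N <= n)%N -> absv (u n - l) < e;
  Qp_rat_dense : forall (x : K) (e : R), 0 < e ->
    exists r : rat, absv (x - ratr r) < e
}.

Section QpN.
Variables (R : realType) (K : fieldType) (absv : K -> R).

Definition QpN : set (nat -> K) :=
  [set xi | exists N : nat, forall i : nat, (N <= i)%N -> absv (xi i) <= 1].

Definition unit_ball (xi : nat -> K) : Prop := forall i, absv (xi i) <= 1.

(* prod_{i in P} Q_p  x  prod_{j notin P} Z_p, for a finite P (given as a seq) *)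
Definition box (P : seq nat) : set (nat -> K) :=
  [set eta | forall j : nat, j \notin P -> absv (eta j) <= 1].

Definition prod_open_in (S U : set (nat -> K)) : Prop :=
  U `<=` S /\
  forall xi, U xi -> exists (F : seq nat) (e : R), 0 < e /\
    forall eta, S eta -> (forall i, i \in F -> absv (eta i - xi i) < e) -> U eta.

Definition tau_open (A : set (nat -> K)) : Prop :=
  A `<=` QpN /\ forall P : seq nat, prod_open_in (box P) (A `&` box P).

Definition tau_closure (S : set (nat -> K)) : set (nat -> K) :=
  [set xi | QpN xi /\ forall U, tau_open U -> U xi -> exists2 eta, U eta & S eta].

Definition tau_compact (C : set (nat -> K)) : Prop :=
  C `<=` QpN /\
  forall F : set (set (nat -> K)), (forall U, F U -> tau_open U) ->
    C `<=` [set xi | exists U, F U /\ U xi] ->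
    exists s : seq (set (nat -> K)), (forall U, List.In U s -> F U) /\
      C `<=` [set xi | exists U, List.In U s /\ U xi].

Definition norm_bounded (S : set (nat -> K)) : Prop :=
  exists M : R, forall xi, S xi -> forall i, absv (xi i) <= M.

(* Operators; only their values on Q_p(N) matter. *)
Definition op := (nat -> K) -> (nat -> K).

Definition maps_QpN (T : op) : Prop := forall xi, QpN xi -> QpN (T xi).

Definition Zp_linear (T : op) : Prop :=
  (forall xi eta, QpN xi -> QpN eta -> forall i,
      T (fun j => xi j + eta j) i = T xi i + T eta i) /\
  (forall (c : K) xi, absv c <= 1 -> QpN xi -> forall i,
      T (fun j => c * xi j) i = c * T xi i).

Definition tau_continuous (T : op) : Prop :=
  forall U, tau_open U -> tau_open [set xi | QpN xi /\ U (T xi)].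

Definition is_bounded_op (T : op) : Prop :=
  [/\ maps_QpN T, Zp_linear T & tau_continuous T].

Definition opnorm_le (T : op) (c : R) : Prop :=
  forall xi, QpN xi -> unit_ball xi -> forall i, absv (T xi i) <= c.

Definition B1 : set op := [set T | is_bounded_op T /\ opnorm_le T 1].

Definition is_compact_op (T : op) : Prop :=
  is_bounded_op T /\
  forall S, S `<=` QpN -> norm_bounded S -> tau_compact (tau_closure (T @` S)).

Definition K1 : set op := [set T | is_compact_op T /\ opnorm_le T 1].

Definition op_add (T S : op) : op := fun xi i => T xi i + S xi i.
Definition op_opp (T : op) : op := fun xi i => - T xi i.
Definition op_mul (T S : op) : op := fun xi => T (S xi).
Definition op_scale (c : K) (T : op) : op := fun xi i => c * T xi i.

Definition norm_closed (A : set op) : Prop :=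
  forall T, is_bounded_op T ->
    (forall e : R, 0 < e -> exists2 a, A a & opnorm_le (op_add T (op_opp a)) e) ->
    A T.

Definition Zp_subalgebra (A : set op) : Prop :=
  [/\ forall T S, A T -> A S -> A (op_add T S),
      forall T S, A T -> A S -> A (op_mul T S)
    & forall (c : K) T, absv c <= 1 -> A T -> A (op_scale c T)].

End QpN.

(* Main.v *)
(* Write [x = a^2 - a], which is compact.  Reducing modulo [p], a compact
   operator takes finitely many values on the unit ball, so two powers of [x]
   agree modulo [p] and some power [y = x^n] is idempotent modulo [p].  Then
   [b = a (1 - y)] differs from [a] by a multiple of [x], and [b^2 - b] is
   nilpotent modulo [p], so Newton's iteration [b |-> 3 b^2 - 2 b^3] converges
   in norm to an idempotent.  All iterates have the form [a + q x] with [q] an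
   integer polynomial in [a], and the factors [q] themselves converge, to a
   bounded operator [h]; hence the limit [a + h x] differs from [a] by [h x],
   which is compact because continuous images of compact sets are compact. *)
Require Import Defs.
From mathcomp Require Import all_boot all_order all_algebra.
From mathcomp Require Import boolp classical_sets reals.
From mathcomp Require Import ring.
Set Implicit Arguments. Unset Strict Implicit. Unset Printing Implicit Defensive.
Import Order.TTheory GRing.Theory Num.Theory.
Local Open Scope ring_scope.
Local Open Scope classical_set_scope.

(** * Newton's iteration for idempotents in a commutative ring *)

Section NewtonIteration.
Variables (A : comPzRingType) (t : A).
Local Notation x := (t ^+ 2 - t).

Definition idem_defect q : A := 1 + 2 * t * q - q + x * q ^+ 2.

Lemma idem_defectE q : (t + x * q) ^+ 2 - (t + x * q) = x * idem_defect q.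
Proof. rewrite /idem_defect; ring. Qed.

(* The substitution [b |-> 3 b^2 - 2 b^3] for [b = t + x q], divided by [x]. *)
Definition newton q : A := q - idem_defect q * (2 * (t + x * q) - 1).

Lemma idem_defect_newton q : idem_defect (newton q) =
  x * idem_defect q ^+ 2 * (4 * (x * idem_defect q) - 3).
Proof. rewrite /newton /idem_defect; ring. Qed.

(** One Newton step squares [b^2 - b] up to a factor. The second divisibility supplies a further
    factor [x * idem_defect q] at each step, which raises the exponent in the first by one; this
    linear rate suffices for convergence. *)
Lemma idem_defect_iter q m : exists s s',
  idem_defect (iter m newton q) = (x * idem_defect q) ^+ m * s /\
  x * idem_defect (iter m newton q) = x * idem_defect q * s'.
Proof.
elim: m => [|m [s [s' [h1 h2]]]].
  by exists (idem_defect q), 1; rewrite expr0 mul1r mulr1.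
rewrite iterS; set v := idem_defect (iter m newton q) in h1 h2.
set z := x * idem_defect q in h1 h2 *.
exists (s * s' * (4 * (x * v) - 3)), (s' * (x * v) * (4 * (x * v) - 3)).
rewrite idem_defect_newton -/v; clearbody v z; split.
  transitivity ((x * v) * v * (4 * (x * v) - 3)); first by ring.
  by rewrite {2}h1 {1}h2 [z ^+ m.+1]exprS; ring.
transitivity ((x * v) * (x * v) * (4 * (x * v) - 3)); first by ring.
by rewrite {1}h2; ring.
Qed.

(** With [y = x^(n+1)] the starting point is [b = t (1 - y)]. Modulo [y - y^2] one has
    [b^2 - b = x (1 - y)], whose power of exponent [n + 1] is [y (1 - y)^(n+1)], a multiple of
    [y - y^2]. So [b^2 - b] is nilpotent as soon as [y] is idempotent. *)
Lemma newton_start n : exists s,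
  (x * idem_defect (- t * x ^+ n)) ^+ n.+1 = (x ^+ n.+1 - (x ^+ n.+1) ^+ 2) * s.
Proof.
set y := x ^+ n.+1; have yE : y = x * x ^+ n by rewrite /y exprS.
have -> : x * idem_defect (- t * x ^+ n) = x * (1 - y) - t ^+ 2 * (y - y ^+ 2).
  by rewrite -idem_defectE yE; move: (x ^+ n) => xn; ring.
set w := x * (1 - y); set z := w - _.
have [s hs] : exists s, z ^+ n.+1 - w ^+ n.+1 = (z - w) * s.
  by eexists; apply: subrXX.
exists ((1 - y) ^+ n - t ^+ 2 * s).
have wX : w ^+ n.+1 = y * ((1 - y) * (1 - y) ^+ n) by rewrite /w exprMn -exprS.
have zw : z - w = - (t ^+ 2 * (y - y ^+ 2)) by rewrite /z addrAC subrr add0r.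
rewrite -[z ^+ _](subrK (w ^+ n.+1)) hs zw wX.
by ring.
Qed.

(** Divisibility form of the fact that a recurrent power sequence contains an idempotent: [1 - a^d]
    divides [1 - a^(m d)], and [a^m] divides [a^(m d)] because [d] is positive. *)
Lemma idem_power_dvd (a : A) m d : (0 < d)%N -> exists s,
  a ^+ (m * d) - (a ^+ (m * d)) ^+ 2 = (a ^+ m - a ^+ (m + d)) * s.
Proof.
move=> d0; have [s hs] : exists s, 1 - (a ^+ d) ^+ m = (1 - a ^+ d) * s.
  by rewrite -[X in X - _](expr1n _ m); eexists; apply: subrXX.
exists (a ^+ (m * d - m) * s).
transitivity (a ^+ (m * d) * (1 - a ^+ (m * d))); first by ring.
rewrite -{1}(subnKC (leq_pmulr m d0)) [(m * d)%N in X in _ * X]mulnC exprM hs !exprD.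
ring.
Qed.

End NewtonIteration.

(** * The p-adic absolute value *)

Section PadicOperators.
Variables (p : nat) (R : realType) (K : fieldType) (absv : K -> R).
Hypothesis p_prime : prime p.
Hypothesis Qp : is_Qp p absv.

Local Notation B1 := (B1 absv).
Local Notation QpN := (QpN absv).
Local Notation ball1 := (unit_ball absv).
Local Notation lin := (Zp_linear absv).
Local Notation bnd := (opnorm_le absv).
Local Notation topen := (tau_open absv).
Local Notation r := ((p%:R : R)^-1).

Lemma absv_ge0 x : 0 <= absv x. Proof. exact: Qp_abs_ge0 Qp x. Qed.

Lemma absvM x y : absv (x * y) = absv x * absv y.
Proof. exact: Qp_absM Qp x y. Qed.

Lemma absv0 : absv 0 = 0. Proof. exact/(Qp_abs_eq0 Qp). Qed.

Lemma absv_gt0 x : x != 0 -> 0 < absv x.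
Proof.
move=> x0; rewrite lt_neqAle absv_ge0 andbT eq_sym; apply: contra_neq x0.
by move/(Qp_abs_eq0 Qp).
Qed.

Lemma absv1 : absv 1 = 1.
Proof. exact: (Qp_abs_coprime Qp (coprime1n p)). Qed.

Lemma absvN x : absv (- x) = absv x.
Proof.
suff h : absv (-1) = 1 by rewrite -mulN1r absvM h mul1r.
by apply/eqP; rewrite -sqrp_eq1 ?absv_ge0 // expr2 -absvM mulrNN mulr1 absv1.
Qed.

Lemma absvV x : absv x^-1 = (absv x)^-1.
Proof.
have [->|x0] := eqVneq x 0; first by rewrite invr0 absv0 invr0.
have h := lt0r_neq0 (absv_gt0 x0).
by apply: (mulIf h); rewrite -absvM !mulVf ?absv1.
Qed.

Lemma absvX x k : absv (x ^+ k) = absv x ^+ k.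
Proof. by elim: k => [|k IH]; rewrite ?expr0 ?absv1 // !exprS absvM IH. Qed.

Lemma absvD_le c x y : absv x <= c -> absv y <= c -> absv (x + y) <= c.
Proof.
by move=> hx hy; apply: (le_trans (Qp_abs_ultra Qp x y)); rewrite ge_max hx hy.
Qed.

Lemma absvB_le c x y : absv x <= c -> absv y <= c -> absv (x - y) <= c.
Proof. by move=> hx hy; apply: absvD_le; rewrite ?absvN. Qed.

Lemma absvD_lt c x y : absv x < c -> absv y < c -> absv (x + y) < c.
Proof.
by move=> hx hy; apply: (le_lt_trans (Qp_abs_ultra Qp x y)); rewrite gt_max hx hy.
Qed.

Lemma absv_distC x y : absv (x - y) = absv (y - x).
Proof. by rewrite -absvN opprB. Qed.

Lemma absv_int (n : int) : absv n%:~R <= 1.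
Proof.
have h (m : nat) : absv m%:R <= 1.
  elim: m => [|m IH]; first by rewrite absv0.
  by rewrite -addn1 natrD absvD_le ?absv1.
by case: n => m; rewrite ?NegzE ?mulrNz ?absvN; apply: h.
Qed.

Lemma r_gt0 : 0 < r. Proof. by rewrite invr_gt0 ltr0n prime_gt0. Qed.

Lemma p_neq0 : (p%:R : K) != 0.
Proof.
apply: contraTneq r_gt0 => h.
by rewrite -(Qp_abs_p Qp) h absv0 ltxx.
Qed.

Lemma absv_pX k : absv (p%:R ^+ k) = r ^+ k.
Proof. by rewrite absvX (Qp_abs_p Qp). Qed.

Lemma rX_lt (e : R) : 0 < e -> exists k, r ^+ k < e.
Proof.
move=> e0; exists (Num.bound e^-1).
rewrite exprVn invf_plt ?posrE ?exprn_gt0 ?ltr0n ?prime_gt0 //.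
rewrite -natrX; apply: (lt_le_trans (archi_boundP _)); first by rewrite invr_ge0 ltW.
by rewrite ler_nat ltnW // ltn_expl // prime_gt1.
Qed.

(** Norm bounds are expressed below by scalars [l] of [K], so that a vector can be divided by [l] to
    land in the unit ball. *)
Lemma absv_large (M : R) : exists2 l : K, l != 0 & M <= absv l.
Proof.
pose M' := Num.max M 1.
have M0 : 0 < M' by rewrite lt_max ltr01 orbT.
have [|k hk] := @rX_lt M'^-1; first by rewrite invr_gt0.
exists (p%:R ^+ k)^-1; first by rewrite invr_eq0 expf_neq0 ?p_neq0.
rewrite absvV absv_pX (@le_trans _ _ M') ?le_max ?lexx //.
by rewrite -[M']invrK lef_pV2 ?posrE ?invr_gt0 ?exprn_gt0 ?r_gt0 ?ltW.
Qed.

(** * Vectors of Q_p(N) and Z_p-linear maps *)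

Lemma ball1_QpN u : ball1 u -> QpN u.
Proof. by move=> hu; exists 0%N => i _. Qed.

Lemma QpN_add u v : QpN u -> QpN v -> QpN (fun j => u j + v j).
Proof.
move=> [N hN] [M hM]; exists (maxn N M) => i; rewrite geq_max => /andP[h1 h2].
by apply: absvD_le; [apply: hN|apply: hM].
Qed.

Lemma QpN_scale c u : absv c <= 1 -> QpN u -> QpN (fun j => c * u j).
Proof.
move=> hc [N hN]; exists N => i hi.
by rewrite absvM mulr_ile1 ?absv_ge0 ?hN.
Qed.

Lemma QpN_sub u v : QpN u -> QpN v -> QpN (fun j => u j - v j).
Proof.
move=> hu [M hM]; apply: QpN_add => //.
by exists M => i hi; rewrite absvN hM.
Qed.

Lemma QpN_bounded u : QpN u -> exists2 l, l != 0 & forall i, absv (u i) <= absv l.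
Proof.
move=> [N hN].
have [M hM] : exists M, forall i, (i < N)%N -> absv (u i) <= M.
  elim: N {hN} => [|N [M hM]]; first by exists 0.
  exists (Num.max M (absv (u N))) => i; rewrite ltnS leq_eqVlt le_max.
  by case/orP=> [/eqP->|/hM->//]; rewrite lexx orbT.
have [l l0 hl] := absv_large (Num.max M 1); exists l => // i.
apply: le_trans hl; rewrite le_max; case: (ltnP i N) => hi; first by rewrite hM.
by rewrite hN ?orbT.
Qed.

Lemma lin_sub T u v i : lin T -> QpN u -> QpN v ->
  T (fun j => u j - v j) i = T u i - T v i.
Proof.
move=> [hT _] hu hv; have := hT _ _ (QpN_sub hu hv) hv i.
have -> : (fun j => u j - v j + v j) = u by apply/funext => j; rewrite subrK.
by move=> ->; rewrite addrK.
Qed.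

(** Linearity over Z_p extends to every scalar of Q_p that keeps the vector in [QpN]: when [l] is
    not integral, [l^-1] is, and it is applied to [l u]. *)
Lemma lin_scale T l u i : lin T -> QpN u -> QpN (fun j => l * u j) ->
  T (fun j => l * u j) i = l * T u i.
Proof.
move=> [_ hT] hu hlu; case: (leP (absv l) 1) => [hl|hl]; first exact: hT.
have l0 : l != 0 by apply: contraTneq hl => ->; rewrite absv0 ltr10.
have hV : absv l^-1 <= 1 by rewrite absvV invf_le1 ?(lt_trans _ hl) ?ltW.
have := hT _ _ hV hlu i.
have -> : (fun j => l^-1 * (l * u j)) = u by apply/funext => j; rewrite mulKf.
by move=> ->; rewrite mulVKf.
Qed.

Lemma lin_zero T i : lin T -> T (fun=> 0) i = 0.
Proof.
have h0 : QpN (fun=> 0) by exists 0%N => j _; rewrite absv0 ler01.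
move=> hT; have := lin_sub i hT h0 h0.
have -> : (fun _ : nat => 0 - 0 : K) = (fun=> 0) by apply/funext => j; rewrite subr0.
by rewrite subrr.
Qed.

Lemma opnorm_le_bounded T c l u : lin T -> bnd T c -> l != 0 -> QpN u ->
  (forall i, absv (u i) <= absv l) -> forall i, absv (T u i) <= c * absv l.
Proof.
move=> hT hc l0 hu hul i; pose v j := l^-1 * u j.
have hv : ball1 v.
  by move=> j; rewrite /v absvM absvV mulrC ler_pdivrMr ?absv_gt0 ?mul1r.
have E : u = (fun j => l * v j) by apply/funext => j; rewrite /v mulVKf.
have hlv : QpN (fun j => l * v j) by rewrite -E.
rewrite E lin_scale //; last exact: ball1_QpN.
by rewrite absvM mulrC ler_wpM2r ?absv_ge0 // hc //; apply: ball1_QpN.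
Qed.

(** * The topology tau and continuity tested on coordinates *)

Definition coord_continuous (T : op K) := forall i (d : R), 0 < d ->
  exists (F : seq nat) (e : R), 0 < e /\ forall u, ball1 u ->
    (forall j, j \in F -> absv (u j) < e) -> absv (T u i) < d.

Lemma box_QpN P u : box absv P u -> QpN u.
Proof.
move=> hu; exists (\max_(j <- P) j.+1) => j hj; apply: hu.
by apply: contraTN hj => hj; rewrite -ltnNge (leq_bigmax_seq _ hj).
Qed.

Lemma QpN_box u : QpN u -> exists P, box absv P u.
Proof.
move=> [N hN]; exists (iota 0 N) => j; rewrite mem_iota add0n -leqNgt; exact: hN.
Qed.

Lemma tau_open_coord i (c : K) (d : R) :
  topen [set u | QpN u /\ absv (u i - c) < d].
Proof.
split=> [u []//|P]; split=> [u []//|u [[hu hd] hP]].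
exists [:: i], d; split; first exact: le_lt_trans (absv_ge0 _) hd.
move=> v hv hF; split=> //; split; first exact: box_QpN hv.
have -> : v i - c = (v i - u i) + (u i - c) by rewrite addrA subrK.
by apply: absvD_lt => //; apply: hF; rewrite inE.
Qed.

(** Inside a box, all but finitely many coordinates of both [c] and the point are integral, so the
    condition there is automatic and only finitely many coordinates are constrained. *)
Lemma tau_open_translate c : QpN c ->
  topen [set u | QpN u /\ forall i, absv (u i - c i) <= 1].
Proof.
move=> [N hN]; split=> [u []//|P]; split=> [u []//|u [[hu hc] hP]].
exists (P ++ iota 0 N), 1; split=> // v hv hF; split=> //.
split=> [|j]; first exact: box_QpN hv.
have [hj|] := boolP (j \in P ++ iota 0 N).
  have -> : v j - c j = (v j - u j) + (u j - c j) by rewrite addrA subrK.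
  by apply: absvD_le => //; apply/ltW/hF.
rewrite mem_cat negb_or mem_iota add0n -leqNgt => /andP[hjP hjN].
by apply: absvB_le; [apply: hv|apply: hN].
Qed.

Lemma tau_open_setI U V : topen U -> topen V -> topen (U `&` V).
Proof.
move=> [hU hU'] [hV hV']; split=> [u [/hU]//|P]; split=> [u []//|u [[uU uV] uP]].
have [_ /(_ _ (conj uU uP)) [F [e [e0 hF]]]] := hU' P.
have [_ /(_ _ (conj uV uP)) [G [d [d0 hG]]]] := hV' P.
exists (F ++ G), (Num.min e d); split=> [|v hv hFG]; first by rewrite lt_min e0.
have [vU _] : (U `&` box absv P) v.
  apply: hF => // i iF; apply: (lt_le_trans (hFG _ _)); first by rewrite mem_cat iF.
  by rewrite ge_min lexx.
have [vV _] : (V `&` box absv P) v.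
  apply: hG => // i iG; apply: (lt_le_trans (hFG _ _)); first by rewrite mem_cat iG orbT.
  by rewrite ge_min lexx orbT.
by [].
Qed.

Lemma tau_open_union (F : set (set (nat -> K))) : (forall U, F U -> topen U) ->
  topen [set u | exists U, F U /\ U u].
Proof.
move=> hF; split=> [u [U [/hF[hU _] /hU]]//|P]; split=> [u []//|u [[U [FU uU]] uP]].
have [_ /(_ P) [_ /(_ _ (conj uU uP))]] := hF _ FU.
move=> [G [e [e0 hG]]]; exists G, e; split=> // v vP hv.
by have [vU _] := hG _ vP hv; split=> //; exists U.
Qed.

Lemma continuous_coord T : maps_QpN absv T -> lin T -> tau_continuous absv T ->
  coord_continuous T.
Proof.
move=> hm hl hc i d d0.
have [_ /(_ [::]) [_ hW]] := hc _ (tau_open_coord i 0 d).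
have z0 : ball1 (fun=> 0) by move=> j; rewrite absv0 ler01.
have [|F [e [e0 hF]]] := hW (fun=> 0).
  split; last by move=> j _; apply: z0.
  split; first exact: ball1_QpN.
  by split; [apply/hm/ball1_QpN|rewrite lin_zero // subr0 absv0].
exists F, e; split=> // u hu hue.
have [//|j hj|[_ [_ h]] _] := hF u; last by rewrite subr0 in h.
by rewrite subr0 hue.
Qed.

Lemma coord_continuous_seq T (F : seq nat) d : coord_continuous T -> 0 < d ->
  exists (G : seq nat) (e : R), 0 < e /\ forall u, ball1 u ->
    (forall j, j \in G -> absv (u j) < e) -> forall i, i \in F -> absv (T u i) < d.
Proof.
move=> hT d0; elim: F => [|i F [G [e [e0 hG]]]]; first by exists [::], 1.
have [H [f [f0 hH]]] := hT i _ d0.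
exists (H ++ G), (Num.min e f); split=> [|u hu huG k]; first by rewrite lt_min e0.
rewrite inE => /orP[/eqP->|hk].
  apply: hH => // j jH; apply: (lt_le_trans (huG _ _)); first by rewrite mem_cat jH.
  by rewrite ge_min lexx orbT.
apply: hG => // j jG; apply: (lt_le_trans (huG _ _)); first by rewrite mem_cat jG orbT.
by rewrite ge_min lexx.
Qed.

(** By linearity it is enough to control [T] on differences [w = v - u] in the unit ball. As [T] has
    norm at most 1, [T w] is integral, so [T v] stays in a box containing [T u], where openness is
    product openness. *)
Lemma coord_continuous_tau T : maps_QpN absv T -> lin T -> bnd T 1 ->
  coord_continuous T -> tau_continuous absv T.
Proof.
move=> hm hl hn hc U [_ hU]; split=> [u []//|P]; split=> [u []//|u [[uQ uU] uP]].
have [Q uQb] := QpN_box (hm _ uQ).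
have [_ /(_ _ (conj uU uQb)) [F [e [e0 hF]]]] := hU Q.
have [G [d [d0 hG]]] := coord_continuous_seq F hc e0.
(* The bound 1 on the coordinates in [P] keeps [v - u] in the unit ball; [d] on [G] makes its image
   small on [F]. *)
exists (P ++ G), (Num.min d 1); split=> [|v vP hv]; first by rewrite lt_min d0 ltr01.
have vQ := box_QpN vP.
pose w j := v j - u j.
have wB : ball1 w.
  move=> j; have [jP|jP] := boolP (j \in P).
    apply/ltW/(lt_le_trans (hv j _)); first by rewrite mem_cat jP.
    by rewrite ge_min lexx orbT.
  by apply: absvB_le; [apply: vP|apply: uP].
have wE i : T w i = T v i - T u i by apply: lin_sub.
split=> //; split=> //.
have [|i iF|//] := hF (T v).
  move=> j jQ; rewrite -[T v j](subrK (T u j)) -wE absvD_le ?uQb //.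
  by apply: hn => //; apply: ball1_QpN.
rewrite -wE; apply: hG => // j jG; apply: (lt_le_trans (hv j _)).
  by rewrite mem_cat jG orbT.
by rewrite ge_min lexx.
Qed.

Lemma B1P T : B1 T <->
  [/\ maps_QpN absv T, lin T, bnd T 1 & coord_continuous T].
Proof.
split=> [[[hm hl hc] hn]|[hm hl hn hc]].
  by split=> //; apply: continuous_coord.
by split=> //; split=> //; apply: coord_continuous_tau.
Qed.

(** * Algebra operations and norm estimates in the unit ball of operators *)

Lemma B1_id : B1 id.
Proof.
apply/B1P; split=> // i d d0; exists [:: i], d; split=> // u _; apply; exact: mem_head.
Qed.

Lemma B1_add T S : B1 T -> B1 S -> B1 (op_add T S).
Proof.
move=> /B1P[hm [hD hZ] hn hc] /B1P[hm' [hD' hZ'] hn' hc']; apply/B1P; split.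
- by move=> u hu; apply: QpN_add; [apply: hm|apply: hm'].
- split=> [u v hu hv i|c u hcu hu i]; rewrite /op_add.
    by rewrite hD // hD' // addrACA.
  by rewrite hZ // hZ' // mulrDr.
- by move=> u hu hb i; apply: absvD_le; [apply: hn|apply: hn'].
- move=> i d d0; have [F [e [e0 hF]]] := hc i _ d0.
  have [G [f [f0 hG]]] := hc' i _ d0.
  exists (F ++ G), (Num.min e f); split=> [|u hu hFG]; first by rewrite lt_min e0.
  apply: absvD_lt; [apply: hF|apply: hG] => // j jF;
    apply: (lt_le_trans (hFG j _)); rewrite ?mem_cat ?jF ?orbT //;
    by rewrite ge_min lexx ?orbT.
Qed.

Lemma B1_scale c T : absv c <= 1 -> B1 T -> B1 (op_scale c T).
Proof.
move=> hc1 /B1P[hm [hD hZ] hn hc]; apply/B1P; split.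
- by move=> u hu; apply: QpN_scale => //; apply: hm.
- split=> [u v hu hv i|d u hd hu i]; rewrite /op_scale.
    by rewrite hD // mulrDr.
  by rewrite hZ // mulrCA.
- by move=> u hu hb i; rewrite absvM mulr_ile1 ?absv_ge0 //; apply: hn.
- move=> i d d0; have [F [e [e0 hF]]] := hc i _ d0.
  exists F, e; split=> // u hu huF; rewrite absvM.
  by apply: le_lt_trans (hF u hu huF); rewrite ler_piMl ?absv_ge0.
Qed.

Lemma bounded_op_mul T S : is_bounded_op absv T -> is_bounded_op absv S ->
  is_bounded_op absv (op_mul T S).
Proof.
move=> [hm [hD hZ] hc] [hm' [hD' hZ'] hc']; split.
- by move=> u hu; apply/hm/hm'.
- split=> [u v hu hv i|c u hcu hu i]; rewrite /op_mul.
    by rewrite -hD; [|exact: hm'..]; congr (T _ i); apply/funext => j; apply: hD'.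
  by rewrite -hZ ?hm' //; [|exact: hm']; congr (T _ i); apply/funext => j; apply: hZ'.
- move=> U hU; have := hc' _ (hc _ hU); congr (topen _).
  apply/seteqP; split=> u /= [hu]; first by case.
  by move=> hUu; split=> //; split=> //; apply: hm'.
Qed.

Lemma B1_mul T S : B1 T -> B1 S -> B1 (op_mul T S).
Proof.
move=> [hT hTn] [hS hSn]; split; first exact: bounded_op_mul.
move=> u hu hb; have hSu := hSn u hu hb.
by apply: hTn => //; apply: ball1_QpN.
Qed.

Lemma opnorm_le_mul T S c k : B1 T -> B1 S -> bnd T c -> bnd S (r ^+ k) ->
  bnd (op_mul T S) (c * r ^+ k).
Proof.
move=> /B1P[_ hl _ _] /B1P[hm _ _ _] hT hS u hu hb i.
rewrite -absv_pX; apply: (@opnorm_le_bounded T) => //.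
- by rewrite expf_neq0 // p_neq0.
- exact: hm.
- by move=> j; rewrite absv_pX; apply: hS.
Qed.

(* Finitely supported vectors lying in [p * QpN] approximate the unit ball. *)
Lemma opnorm_le_r T : B1 T ->
  (forall u, QpN u -> (forall i, absv (u i) <= p%:R) -> ball1 (T u)) -> bnd T r.
Proof.
move=> /B1P[hm hl hn hc] hT u hu hb i.
have [F [e [e0 hF]]] := hc i _ r_gt0.
(* Here [u = p v + w]. Only the finitely many coordinates in [F] are divided by [p], so [v] stays in
   [QpN], while [w] vanishes on [F] and has a small image at coordinate [i]. *)
pose v j := p%:R^-1 * (if j \in F then u j else 0).
pose w j := if j \in F then 0 else u j.
have hw : ball1 w by move=> j; rewrite /w; case: ifP => _ //; rewrite absv0.
have absvp : absv p%:R^-1 = p%:R by rewrite absvV (Qp_abs_p Qp) invrK.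
have hv : QpN v.
  apply: (@box_QpN F) => j /negbTE jF.
  by rewrite /v jF mulr0 absv0.
have hvp j : absv (v j) <= p%:R.
  rewrite /v absvM absvp ler_piMr ?ler0n //; case: ifP => _ //.
  by rewrite absv0.
have hpv : QpN (fun j => p%:R * v j).
  apply: QpN_scale => //; exact: (absv_int p).
have -> : u = (fun j => p%:R * v j + w j).
  by apply/funext => j; rewrite /v /w mulVKf ?p_neq0 //; case: ifP; rewrite ?addr0 ?add0r.
have [hD _] := hl; rewrite hD //; last exact: ball1_QpN.
apply: absvD_le; last first.
  by apply/ltW/hF => // j jF; rewrite /w jF absv0.
rewrite lin_scale // absvM (Qp_abs_p Qp) ler_piMr ?(ltW r_gt0) //.
exact: hT.
Qed.

(** * Compact sets for tau and compact operators *)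

Lemma tau_open_QpN : topen QpN.
Proof.
split=> [//|P]; split=> [u []//|u [_ uP]]; exists [::], 1; split=> // v vP _.
by split=> //; apply: box_QpN vP.
Qed.

Lemma tau_open_bigcap n (V : 'I_n -> set (nat -> K)) : (forall k, topen (V k)) ->
  topen [set u | QpN u /\ forall k, V k u].
Proof.
elim: n V => [|n IH] V hV.
  have -> : [set u | QpN u /\ forall k, V k u] = QpN.
    by apply/seteqP; split=> u /= => [[]//|hu]; split=> // -[].
  exact: tau_open_QpN.
have -> : [set u | QpN u /\ forall k, V k u] =
    V ord0 `&` [set u | QpN u /\ forall k, V (lift ord0 k) u].
  apply/seteqP; split=> u /= => [[hu h]|[h0 [hu h]]]; first by split=> //; split.
  by split=> // k; case: (unliftP ord0 k) => [k' ->|->].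
by apply: tau_open_setI => //; apply: IH.
Qed.

Lemma In_finite_range (T : Type) n (f : 'I_n -> T) :
  exists s, forall x, List.In x s <-> exists k, f k = x.
Proof.
elim: n f => [|n IH] f; first by exists [::] => x; split=> // -[[]].
have [s hs] := IH (fun k => f (lift ord0 k)).
exists (f ord0 :: s) => x /=; split=> [[<-|/hs[k <-]]|[k <-]].
- by exists ord0.
- by exists (lift ord0 k).
- case: (unliftP ord0 k) => [k' ->|->]; last by left.
  by right; apply/hs; exists k'.
Qed.

Lemma In_index (T I : Type) (P : I -> T -> Prop) (s : seq T) :
  (forall x, List.In x s -> exists i, P i x) ->
  exists n (f : 'I_n -> I), (forall k, exists x, P (f k) x) /\
    forall x, List.In x s -> exists k, P (f k) x.
Proof.
elim: s => [|x s IH] h.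
  by exists 0%N, (fun k : 'I_0 => False_rect I (notF (ltn_ord k))); split=> // -[].
have [n [f [hf hs]]] := IH (fun y hy => h y (or_intror hy)).
have [i0 hi0] := h x (or_introl erefl).
exists n.+1, (fun k => if unlift ord0 k is Some k' then f k' else i0).
split=> [k|y [<-|/hs[k hk]]].
- by case: (unlift ord0 k) => [k'|]; [apply: hf|exists x].
- by exists ord0; rewrite unlift_none.
- by exists (lift ord0 k); rewrite liftK.
Qed.

(** Indexing the cover lets the finite subcover retain data attached to its members, such as the
    centre of a translate or a disjoint partner set. *)
Lemma tau_compact_indexed C (I : Type) (D : set I) (U : I -> set (nat -> K)) :
  tau_compact absv C -> (forall i, D i -> topen (U i)) ->
  (forall u, C u -> exists2 i, D i & U i u) ->
  exists n (f : 'I_n -> I), (forall k, D (f k)) /\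
    forall u, C u -> exists k, U (f k) u.
Proof.
move=> [_ hC] hU hcov.
have [||s [hsF hs]] := hC [set V | exists2 i, D i & U i = V].
- by move=> V [i Di <-]; apply: hU.
- by move=> u /hcov [i Di Ui]; exists (U i); split=> //; exists i.
have [V Vs|n [f [hf hfs]]] := @In_index _ _ (fun i V => D i /\ U i = V) s.
  by have [i Di Ui] := hsF V Vs; exists i.
exists n, f; split=> [k|u /hs [V [Vs Vu]]]; first by have [V []] := hf k.
by have [k [_ kV]] := hfs V Vs; exists k; rewrite kV.
Qed.

Lemma indexed_tau_compact C : C `<=` QpN ->
  (forall (F : set (set (nat -> K))), (forall U, F U -> topen U) ->
    (forall u, C u -> exists2 U, F U & U u) ->
    exists n (f : 'I_n -> set (nat -> K)), (forall k, F (f k)) /\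
      forall u, C u -> exists k, f k u) ->
  tau_compact absv C.
Proof.
move=> CQ hC; split=> // F hF hcov.
have [//||n [f [fF hf]]] := hC F; first by move=> u /hcov[U []]; exists U.
have [s hs] := In_finite_range f; exists s; split=> [U /hs[k <-]//|u /hf[k hk]].
by exists (f k); split=> //; apply/hs; exists k.
Qed.

Lemma tau_compact_image h C : is_bounded_op absv h -> tau_compact absv C ->
  tau_compact absv (h @` C).
Proof.
move=> [hm _ hc] hC; have [CQ _] := hC.
apply: indexed_tau_compact => [_ [u /CQ hu <-]|F hF hcov]; first exact: hm.
have [||n [f [fF hf]]] := @tau_compact_indexed C _ F
  (fun U => [set u | QpN u /\ U (h u)]) hC.
- by move=> U /hF; apply: hc.
- move=> u Cu; have [|U FU Uu] := hcov (h u); first by exists u.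
  by exists U => //; split=> //; apply: CQ.
by exists n, f; split=> // _ [u /hf [k [_ hk]] <-]; exists k.
Qed.

(** Compact sets are closed because tau is Hausdorff: the finitely many neighbourhoods of [z] paired
    with a subcover of [C] intersect in a neighbourhood of [z] that misses [S]. *)
Lemma tau_closure_compact C S : tau_compact absv C -> S `<=` C ->
  tau_closure absv S `<=` C.
Proof.
move=> hC SC z [zQ hz]; apply: contrapT => Cz; have [CQ _] := hC.
have [||n [f [fD hf]]] := @tau_compact_indexed C _ [set UV |
    [/\ topen UV.1, topen UV.2, UV.2 z & forall u, UV.1 u -> UV.2 u -> False]]
  fst hC.
- by move=> UV [].
- move=> c Cc; have [i ci] : exists i, c i != z i.
    apply: contrapT => h; apply: Cz; suff <- : c = z by [].
    by apply/funext => i; apply/eqP; apply: contrapT => /negP hi; apply: h; exists i.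
  have d0 : 0 < absv (c i - z i) by apply: absv_gt0; rewrite subr_eq0.
  (* The radius can be the full distance of the two coordinates: by the ultrametric inequality such
     open balls are already disjoint. *)
  exists ([set u | QpN u /\ absv (u i - c i) < absv (c i - z i)],
          [set u | QpN u /\ absv (u i - z i) < absv (c i - z i)]); last first.
    by split=> /=; [apply: CQ|rewrite subrr absv0].
  split=> /=; [exact: tau_open_coord..| |].
    by rewrite subrr absv0.
  move=> u [_ h1] [_ h2].
  have := absvD_lt (x := c i - u i) (y := u i - z i).
  by move/(_ _ (etrans (congr1 (fun t => t < _) (absv_distC _ _)) h1) h2);
    rewrite addrA subrK ltxx.
have [||v [vQ hv] Sv] := hz [set u | QpN u /\ forall k, (f k).2 u].
- by apply: tau_open_bigcap => k; have [] := fD k.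
- by split=> // k; have [] := fD k.
have [k hk] := hf v (SC _ Sv).
by have [_ _ _ /(_ v hk (hv k))] := fD k.
Qed.

Lemma tau_closure_compl_open S : topen [set u | QpN u /\ ~ tau_closure absv S u].
Proof.
have -> : [set u | QpN u /\ ~ tau_closure absv S u] =
    [set u | exists U, (topen U /\ U `&` S `<=` set0) /\ U u].
  apply/seteqP; split=> u /=.
    move=> [uQ hu]; apply: contrapT => h; apply: hu; split=> // U hU Uu.
    apply: contrapT => hS; apply: h; exists U; split=> //; split=> // v [Uv Sv].
    by case: hS; exists v.
  move=> [U [[hU hS] Uu]]; have [UQ _] := hU; split; first exact: UQ.
  by move=> [_ /(_ _ hU Uu)] [v Uv Sv]; apply: (hS v).
by apply: tau_open_union => U [].
Qed.

Lemma tau_compact_closure C S : tau_compact absv C -> S `<=` C ->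
  tau_compact absv (tau_closure absv S).
Proof.
move=> hC SC; have clC := tau_closure_compact hC SC.
apply: indexed_tau_compact => [u []//|F hF hcov].
have [[u0 cu0]|none] := pselect (exists u, tau_closure absv S u); last first.
  exists 0%N, (fun=> setT); split=> [[]//|u hu].
  by case: none; exists u.
have [U0 FU0 _] := hcov _ cu0; have [CQ _] := hC.
(* The open complement of the closure is absorbed into each member of [F], so a finite subcover of
   [C] is still indexed by [F]. This requires [F] to be inhabited, whence the separate case of an
   empty closure. *)
pose V U := [set u | exists W,
  (W = U \/ W = [set u | QpN u /\ ~ tau_closure absv S u]) /\ W u].
have [||n [f [fF hf]]] := @tau_compact_indexed C _ F V hC.
- move=> U FU; apply: tau_open_union => W [->|->]; first exact: hF.
  exact: tau_closure_compl_open.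
- move=> u Cu; have [/hcov[U FU Uu]|nu] := pselect (tau_closure absv S u).
    by exists U => //; exists U; split=> //; left.
  exists U0 => //; exists [set u | QpN u /\ ~ tau_closure absv S u].
  by split; [right|split=> //; apply: CQ].
exists n, f; split=> // u hu; have [k [W [[->|->] h]]] := hf u (clC _ hu).
  by exists k.
by case: h.
Qed.

(** The image of [S] under the composite lies in [h] of the compact closure of [x S], which is
    compact, and closures of subsets of compact sets are compact. *)
Lemma K1_mul h x : B1 h -> K1 absv x -> K1 absv (op_mul h x).
Proof.
move=> hh [[hx hcomp] hxn]; have [hhb _] := hh.
have [hxh hn] : B1 (op_mul h x) by apply: B1_mul.
split=> //; split=> // S SQ hS; have [hxm _ _] := hx.
apply: tau_compact_closure (tau_compact_image hhb (hcomp S SQ hS)) _.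
move=> _ [u Su <-]; exists (x u) => //; split; first exact/hxm/SQ.
by move=> U _ Uu; exists (x u) => //; exists u.
Qed.

(** * Norm limits of operators *)

Lemma B1_opp T : B1 T -> B1 (op_opp T).
Proof.
move=> hT; have -> : op_opp T = op_scale (-1) T.
  by apply/funext => u; apply/funext => i; rewrite /op_opp /op_scale mulN1r.
by apply: B1_scale hT; rewrite absvN absv1.
Qed.

Lemma B1_sub T S : B1 T -> B1 S -> B1 (op_add T (op_opp S)).
Proof. by move=> hT hS; apply: B1_add hT (B1_opp hS). Qed.

Lemma absv_small0 x (M : R) : 0 < M -> (forall k, absv x <= r ^+ k * M) -> x = 0.
Proof.
move=> M0 h; apply/eqP; apply: contrapT => /negP x0.
have [|k hk] := @rX_lt (absv x / M); first by rewrite divr_gt0 ?absv_gt0.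
have := le_lt_trans (h k) (_ : r ^+ k * M < absv x).
by rewrite ltxx -ltr_pdivlMr // => /(_ hk).
Qed.

Lemma rX_gt0 k : 0 < r ^+ k. Proof. by rewrite exprn_gt0 ?r_gt0. Qed.

Lemma QpN_bounded2 u v : QpN u -> QpN v -> exists2 l, l != 0 &
  (forall i, absv (u i) <= absv l) /\ (forall i, absv (v i) <= absv l).
Proof.
move=> /QpN_bounded[l l0 hl] /QpN_bounded[m m0 hm].
have [n n0] := absv_large (Num.max (absv l) (absv m)).
rewrite ge_max => /andP[hln hmn]; exists n => //; split=> i.
  exact: le_trans hln.
exact: le_trans hmn.
Qed.

Lemma B1_limit (T : nat -> op K) (N : nat -> nat) : (forall m, B1 (T m)) ->
  (forall k m, (N k <= m)%N -> bnd (op_add (T m.+1) (op_opp (T m))) (r ^+ k)) ->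
  exists h, B1 h /\ forall k m, (N k <= m)%N -> bnd (op_add h (op_opp (T m))) (r ^+ k).
Proof.
move=> hT hN.
(* The ultrametric inequality turns bounds on consecutive differences into the same bound on all
   later differences. *)
have cauchy k m d u l i : (N k <= m)%N -> QpN u -> l != 0 ->
    (forall j, absv (u j) <= absv l) ->
    absv (T (m + d)%N u i - T m u i) <= r ^+ k * absv l.
  move=> km hu l0 hl; elim: d => [|d IH].
    by rewrite addn0 subrr absv0 mulr_ge0 ?absv_ge0 ?(ltW (rX_gt0 k)).
  rewrite -[_ - _](subrKA (T (m + d)%N u i)); apply: absvD_le => //.
  rewrite addnS.
  apply: (@opnorm_le_bounded (op_add (T (m + d).+1) (op_opp (T (m + d)%N)))) => //.
    by have /B1P[] := B1_sub (hT (m + d).+1) (hT (m + d)%N).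
  by apply: hN; rewrite (leq_trans km) ?leq_addr.
(* The hypothesis on [u] is placed under the existential so that [choice] yields a total function;
   the value 0 is taken outside [QpN]. *)
have lim u i : exists x, QpN u -> forall k m l, (N k <= m)%N -> l != 0 ->
    (forall j, absv (u j) <= absv l) -> absv (x - T m u i) <= r ^+ k * absv l.
  have [hu|nu] := pselect (QpN u); last by exists 0.
  have [l l0 hl] := QpN_bounded hu.
  have [|x hx] := Qp_complete Qp (u := fun m => T m u i).
    move=> e e0; have [|k hk] := @rX_lt (e / absv l).
      by rewrite divr_gt0 ?absv_gt0.
    rewrite ltr_pdivlMr ?absv_gt0 // in hk.
    exists (N k) => m n hm hn.
    rewrite -[_ - _](subrKA (T (N k) u i)); apply: absvD_lt; last rewrite absv_distC.
      by rewrite -(subnKC hm); apply: le_lt_trans hk; apply: cauchy.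
    by rewrite -(subnKC hn); apply: le_lt_trans hk; apply: cauchy.
  exists x => _ k m l' km l'0 hl'.
  have [|M hM] := hx (r ^+ k * absv l'); first by rewrite mulr_gt0 ?rX_gt0 ?absv_gt0.
  rewrite -[_ - _](subrKA (T (m + M)%N u i)); apply: absvD_le; last exact: cauchy.
  by rewrite absv_distC; apply/ltW/hM; rewrite leq_addl.
have [h hh] := choice (fun ui : (nat -> K) * nat => lim ui.1 ui.2).
have {h hh} [h hlim] : exists h : op K, forall u i k m l, QpN u ->
    (N k <= m)%N -> l != 0 -> (forall j, absv (u j) <= absv l) ->
    absv (h u i - T m u i) <= r ^+ k * absv l.
  by exists (fun u i => h (u, i)) => u i k m l hu; apply: (hh (u, i)).
have hbnd k m : (N k <= m)%N -> bnd (op_add h (op_opp (T m))) (r ^+ k).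
  move=> km u hu hb i; have := hlim u i k m 1 hu km (oner_neq0 _).
  by rewrite absv1 mulr1; apply.
exists h; split=> //; apply/B1P; split.
- move=> u hu; have [l l0 hl] := QpN_bounded hu.
  (* With [r^k |l| < 1] the error is integral in every coordinate, so [h u] is integral wherever
     [T (N k) u] is. *)
  have [|k hk] := @rX_lt (absv l)^-1; first by rewrite invr_gt0 absv_gt0.
  have /B1P[/(_ _ hu) [M hM] _ _ _] := hT (N k).
  exists M => i Mi; rewrite -[h u i](subrK (T (N k) u i)).
  apply: absvD_le; last exact: hM.
  apply: le_trans (hlim u i k _ l hu (leqnn _) l0 hl) _.
  by rewrite -ler_pdivlMr ?absv_gt0 // mul1r ltW.
- split=> [u v hu hv i|c u hc hu i].
    have [l l0 [hl1 hl2]] := QpN_bounded2 hu hv.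
    (* The additivity defect of [h] is at most [r^k |l|] for every [k], since each approximant is
       additive; homogeneity is treated likewise. *)
    apply/eqP; rewrite -subr_eq0; apply/eqP.
    apply: (@absv_small0 _ (absv l)); first exact: absv_gt0.
    move=> k; have /B1P[_ [hD _] _ _] := hT (N k).
    have -> : h (fun j => u j + v j) i - (h u i + h v i) =
      (h (fun j => u j + v j) i - T (N k) (fun j => u j + v j) i)
      - ((h u i - T (N k) u i) + (h v i - T (N k) v i)).
      by rewrite hD //; ring.
    apply: absvB_le; last by apply: absvD_le; apply: hlim.
    by apply: hlim => //; [apply: QpN_add|move=> j; apply: absvD_le].
  have [l l0 hl] := QpN_bounded hu.
  apply/eqP; rewrite -subr_eq0; apply/eqP.
  apply: (@absv_small0 _ (absv l)); first exact: absv_gt0.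
  move=> k; have /B1P[_ [_ hZ] _ _] := hT (N k).
  have -> : h (fun j => c * u j) i - c * h u i =
    (h (fun j => c * u j) i - T (N k) (fun j => c * u j) i)
    - c * (h u i - T (N k) u i).
    by rewrite hZ //; ring.
  have cle x : absv (c * x) <= absv x by rewrite absvM ler_piMl ?absv_ge0.
  apply: absvB_le; last by apply: le_trans (cle _) _; apply: hlim.
  by apply: hlim => //; [apply: QpN_scale|move=> j; apply: le_trans (cle _) (hl j)].
- move=> u hu hb i; rewrite -[h u i](subrK (T (N 0%N) u i)).
  apply: absvD_le; last by have [_] := hT (N 0%N); apply.
  exact: (hbnd 0%N).
- move=> i d d0; have [k hk] := rX_lt d0.
  have /B1P[_ _ _ /(_ i _ d0) [F [e [e0 hF]]]] := hT (N k).
  exists F, e; split=> // u hu huF; rewrite -[h u i](subrK (T (N k) u i)).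
  apply: absvD_lt; last exact: hF.
  by apply: le_lt_trans hk; apply: hbnd => //; apply: ball1_QpN.
Qed.

(** * Recurrence of compact operators modulo p *)

Lemma B1_congr T u v : B1 T -> QpN u -> QpN v ->
  (forall i, absv (u i - v i) <= 1) -> forall i, absv (T u i - T v i) <= 1.
Proof.
move=> /B1P[_ hl hn _] hu hv h i; rewrite -lin_sub //.
by apply: hn; first exact: QpN_sub.
Qed.

Lemma B1_iter T m : B1 T -> B1 (iter m T).
Proof. by move=> hT; elim: m => [|m IH]; [exact: B1_id|apply: (B1_mul hT IH)]. Qed.

Lemma B1_bounded T l u : B1 T -> l != 0 -> QpN u ->
  (forall i, absv (u i) <= absv l) -> forall i, absv (T u i) <= absv l.
Proof.
move=> /B1P[_ hl hn _] l0 hu hul i; rewrite -[absv l]mul1r.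
exact: opnorm_le_bounded.
Qed.

(** Pigeonhole on the finite set of self-maps rather than on orbits, so that one pair of exponents
    serves all points at once. *)
Lemma iter_collision n (f : 'I_n -> 'I_n) :
  exists i j, (i < j)%N /\ iter i f =1 iter j f.
Proof.
pose g (m : 'I_(#|{ffun 'I_n -> 'I_n}|.+1)) := finfun (iter m f).
have /injectivePn[i [j ij /ffunP gij]] : ~~ injectiveb g.
  by apply/negP => /injectiveP /leq_card; rewrite card_ord ltnn.
have {}gij : iter i f =1 iter j f by move=> k; have := gij k; rewrite !ffunE.
case: (ltngtP i j) => hij; first by exists i, j.
  by exists j, i; split=> // k; rewrite gij.
by case/eqP: ij; apply: val_inj.
Qed.

(* Translates of the unit ball are open, so finitely many of them cover the
   image under [x] of the ball of radius [p]: modulo [p], the orbits of [x] on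
   the unit ball are governed by a self-map of a finite set. *)
Lemma compact_op_recurrent x : K1 absv x -> exists i j, (0 < i < j)%N /\
  bnd (op_add (iter i x) (op_opp (iter j x))) r.
Proof.
move=> [[hx hcomp] hxn]; have hB : B1 x by [].
have [hxm _ _] := hx.
(* The radius is [p] because, by [opnorm_le_r], a bound by 1 on this ball gives the bound [r] on the
   unit ball. *)
pose S := [set u | QpN u /\ forall i, absv (u i) <= p%:R].
have absvp : absv p%:R^-1 = p%:R by rewrite absvV (Qp_abs_p Qp) invrK.
have xS u : S u -> S (x u).
  move=> [hu hup]; split; first exact: hxm.
  by move: hup; rewrite -absvp => hup; apply: B1_bounded; rewrite ?invr_eq0 ?p_neq0.
have SQ : S `<=` QpN by move=> u [].
have bS : norm_bounded absv S by exists p%:R => u [].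
have [||n [eta [etaS hcov]]] := @tau_compact_indexed _ _ S
  (fun v => [set w | QpN w /\ forall i, absv (w i - x v i) <= 1]) (hcomp S SQ bS).
- by move=> v /SQ hv; apply: tau_open_translate; apply: hxm.
- move=> w [wQ hw].
  (* Every point of the closure is within distance 1 of some [x v] with [v] in [S], so the centres
     can be chosen in [x S] itself. *)
  have [|w' [_ hv] [v Sv E]] := hw _ (tau_open_translate wQ).
    by split=> // i; rewrite subrr absv0 ler01.
  by exists v => //; split=> // i; rewrite absv_distC E; apply: hv.
have {}hcov u : S u -> exists k, forall i, absv (x u i - x (eta k) i) <= 1.
  move=> Su; have [|k [_ hk]] := hcov (x u); last by exists k.
  split; first exact/hxm/SQ.
  by move=> U _ Ux; exists (x u) => //; exists u.
(* [f k] names a translate containing [x (x (eta k))]; following [f] tracks the orbit of [eta k] up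
   to integral vectors. *)
have [f hf] := choice (fun k => hcov _ (xS _ (etaS k))).
have orbit m k i : absv (iter m.+1 x (eta k) i - x (eta (iter m f k)) i) <= 1.
  elim: m k i => [|m IH] k i; first by rewrite subrr absv0 ler01.
  rewrite 2!iterSr [iter m.+1 f k]iterSr -[_ - _](subrKA (iter m.+1 x (eta (f k)) i)).
  apply: absvD_le; last exact: IH.
  rewrite iterSr; apply: B1_congr => //; first exact: B1_iter.
    exact: hxm (hxm _ (SQ _ (etaS k))).
  by apply/hxm/SQ.
have [i [j [ij fij]]] := iter_collision f.
(* The exponents are shifted by one because the cover approximates [x u] and not [u]; this also
   makes the smaller one positive. *)
exists i.+1, j.+1; split; first by rewrite ltnS.
apply: opnorm_le_r; first by apply: B1_sub; apply: B1_iter.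
move=> u uQ up l; have Su : S u by [].
have [k hk] := hcov u Su.
have near m : absv (iter m.+1 x u l - x (eta (iter m f k)) l) <= 1.
  rewrite -[_ - _](subrKA (iter m.+1 x (eta k) l)).
  apply: absvD_le; last exact: orbit.
  by rewrite !iterSr; apply: B1_congr => //; [apply: B1_iter|apply: hxm|apply/hxm/SQ].
rewrite /op_add /op_opp -[_ - _](subrKA (x (eta (iter i f k)) l)).
by apply: absvD_le; [apply: near|rewrite absv_distC fij; apply: near].
Qed.

(** * Integer polynomials in an operator and the lifting of the idempotent *)

Section PolynomialCalculus.
Variable a : op K.
Hypothesis B1a : B1 a.

(** Evaluation at [a], written with iterates: values of operators outside [QpN] are arbitrary, so
    [op K] is not a ring under composition. The Newton identities are proved in the commutative ring
    [{poly int}] and transported from there. *)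
Definition horner_op (q : {poly int}) : op K :=
  fun u i => \sum_(j < size q) (q`_j)%:~R * iter j a u i.

Lemma horner_op_widen n (q : {poly int}) u i : (size q <= n)%N ->
  horner_op q u i = \sum_(j < n) (q`_j)%:~R * iter j a u i.
Proof.
move=> h; rewrite /horner_op (big_ord_widen n (fun j => (q`_j)%:~R * iter j a u i)) //.
rewrite big_mkcond; apply: eq_bigr => j _; case: ltnP => // hj.
by rewrite nth_default // mul0r.
Qed.

Lemma horner_opD q s : horner_op (q + s) = op_add (horner_op q) (horner_op s).
Proof.
apply/funext => u; apply/funext => i; rewrite /op_add.
pose n := maxn (size q) (size s).
rewrite !(@horner_op_widen n) ?size_polyD ?leq_maxl ?leq_maxr // -big_split /=.
by apply: eq_bigr => j _; rewrite coefD rmorphD /= mulrDl.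
Qed.

Lemma horner_opN q : horner_op (- q) = op_opp (horner_op q).
Proof.
apply/funext => u; apply/funext => i; rewrite /op_opp /horner_op size_polyN -sumrN.
by apply: eq_bigr => j _; rewrite coefN rmorphN mulNr.
Qed.

Lemma horner_opC c : horner_op c%:P = op_scale c%:~R id.
Proof.
apply/funext => u; apply/funext => i.
by rewrite (@horner_op_widen 1) ?size_polyC_leq1 // big_ord1 coefC.
Qed.

Lemma horner_opMX q : horner_op (q * 'X) = op_mul (horner_op q) a.
Proof.
apply/funext => u; apply/funext => i.
rewrite (@horner_op_widen (size q).+1); last first.
  by rewrite (leq_trans (size_polyMleq _ _)) // size_polyX addn2.
rewrite big_ord_recl coefMX mul0r add0r; apply: eq_bigr => j _.
by rewrite coefMX /= -iterS iterSr.
Qed.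

Lemma B1_horner q : B1 (horner_op q).
Proof.
elim/poly_ind: q => [|q c IH].
  by rewrite -[0]/(0%:P) horner_opC; apply: B1_scale B1_id; apply: absv_int.
rewrite horner_opD horner_opMX horner_opC; apply: B1_add; first exact: B1_mul.
by apply: B1_scale B1_id; apply: absv_int.
Qed.

(** Restricted to [QpN] because moving the coefficients of [s] through [horner_op q] uses its
    linearity. *)
Lemma horner_opM q s u : QpN u -> horner_op (q * s) u = horner_op q (horner_op s u).
Proof.
have /B1P[am _ _ _] := B1a.
have /B1P[_ [qD qZ] _ _] := B1_horner q.
elim/poly_ind: s u => [|s c IH] u hu.
  rewrite mulr0 -[0]/(0%:P) horner_opC; apply/funext => i.
  by rewrite /op_scale qZ ?absv_int // mulr0z !mul0r.
have /B1P[sm _ _ _] := B1_horner s.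
rewrite mulrDr mulrA !horner_opD !horner_opMX horner_opC [q * _%:P]mulrC mul_polyC.
apply/funext => i; rewrite /op_add /op_mul /op_scale qD; last first.
- by apply: QpN_scale; rewrite ?absv_int.
- exact/sm/am.
rewrite qZ ?absv_int // IH; last exact: am.
congr (_ + _); rewrite (@horner_op_widen (size q)) ?size_scale_leq // big_distrr /=.
by apply: eq_bigr => j _; rewrite coefZ rmorphM mulrA.
Qed.

(** Turns divisibility of integer polynomials into a norm estimate: the cofactor [s] preserves the
    unit ball. *)
Lemma horner_opM_le q s c : bnd (horner_op q) c -> bnd (horner_op (q * s)) c.
Proof.
move=> hq u hu hb i; rewrite horner_opM //.
have [_ hs] := B1_horner s.
by apply: hq; [apply: ball1_QpN|]; apply: hs.
Qed.

Lemma horner_opX_le q k : bnd (horner_op q) r -> bnd (horner_op (q ^+ k)) (r ^+ k).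
Proof.
move=> hq; elim: k => [|k IH]; first by rewrite expr0; have [] := B1_horner (q ^+ 0).
rewrite !exprS => u hu hb i; rewrite horner_opM //.
exact: (opnorm_le_mul (B1_horner q) (B1_horner (q ^+ k)) hq IH).
Qed.

Local Notation x := ('X^2 - 'X : {poly int}).

Lemma horner_op_defect : horner_op x = op_add (op_mul a a) (op_opp a).
Proof.
have X1 : horner_op 'X = a.
  rewrite -['X]mul1r horner_opMX horner_opC.
  by apply/funext => u; apply/funext => i; rewrite /op_mul /op_scale mul1r.
by rewrite horner_opD horner_opN expr2 horner_opMX X1.
Qed.

Lemma idempotent_correction : K1 absv (op_add (op_mul a a) (op_opp a)) ->
  exists2 h, B1 h & let e := op_add a (op_mul h (op_add (op_mul a a) (op_opp a))) in
    forall u, QpN u -> forall i, e (e u) i = e u i.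
Proof.
rewrite -horner_op_defect => hK.
have horner_iter m u : QpN u -> iter m (horner_op x) u = horner_op (x ^+ m) u.
  move=> hu; elim: m => [|m IH] /=.
    by rewrite expr0 horner_opC; apply/funext => i; rewrite /op_scale mul1r.
  by rewrite IH -horner_opM // -exprS.
have [m [j [/andP[m0 mj] hmj]]] := compact_op_recurrent hK.
(* The power [x^(n+1)] is the one that is idempotent modulo [p]. The predecessor appears because
   [q0] carries one factor [x] less than the correction [x * q0]. *)
pose n := (m * (j - m)).-1.
have nE : n.+1 = (m * (j - m))%N by rewrite prednK // muln_gt0 m0 subn_gt0.
pose q0 : {poly int} := - 'X * x ^+ n.
pose z := x * idem_defect 'X q0.
(* [z^(n+1)] is a multiple of [x^m - x^j], which has norm at most [r] by recurrence; hence [z] is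
   nilpotent modulo [p]. *)
have hz : bnd (horner_op (z ^+ n.+1)) r.
  have [s ->] := newton_start ('X : {poly int}) n.
  apply: horner_opM_le; rewrite nE.
  have [s' ->] := @idem_power_dvd _ x m (j - m) (etrans (subn_gt0 _ _) mj).
  apply: horner_opM_le; rewrite subnKC ?(ltnW mj) // horner_opD horner_opN => u hu hb i.
  by rewrite /op_add /op_opp -!horner_iter //; apply: hmj.
have hzk k l s : (n.+1 * k <= l)%N -> bnd (horner_op (z ^+ l * s)) (r ^+ k).
  move=> kl; rewrite -(subnKC kl) exprD exprM -mulrA.
  exact/horner_opM_le/horner_opX_le.
pose q l := iter l (newton ('X : {poly int})) q0.
(* Consecutive factors [q l] differ by a multiple of [z^l], of norm at most [r^k] once [l] reaches
   [(n + 1) k]. *)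
have [||h [hB hlim]] := @B1_limit (fun l => horner_op (q l)) (fun k => n.+1 * k)%N.
- by move=> l; apply: B1_horner.
- move=> k l kl; rewrite -horner_opN -horner_opD.
  have [s [_ [hs _]]] := idem_defect_iter ('X : {poly int}) q0 l.
  rewrite /q iterS [newton _ _]/newton hs -/(q l) addrAC subrr add0r.
  by rewrite -mulrN -mulrA; apply: hzk.
exists h => // e u hu i.
have eB : B1 e by apply: B1_add => //; apply: B1_mul => //; apply: B1_horner.
have [l l0 hul] := QpN_bounded hu.
(* The Newton iterate that approximates [e] within [r^k]. *)
pose b k := 'X + x * q (n.+1 * k)%N.
have approx k v c : QpN v -> c != 0 -> (forall i, absv (v i) <= absv c) ->
    forall i, absv (e v i - horner_op (b k) v i) <= r ^+ k * absv c.
  move=> hv c0 hvc i'.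
  have hxv : QpN (horner_op x v) by have /B1P[xm _ _ _] := B1_horner x; apply: xm.
  have -> : e v i' - horner_op (b k) v i' =
    op_add h (op_opp (horner_op (q (n.+1 * k)%N))) (horner_op x v) i'.
    rewrite /b [x * _]mulrC -[X in X + _ * _]mul1r horner_opD horner_opMX horner_opC.
    rewrite /e /op_add /op_mul /op_opp /op_scale horner_opM // mul1r.
    by rewrite opprD addrACA subrr add0r.
  apply: (@opnorm_le_bounded (op_add h _)) => //.
  - by have /B1P[] := B1_sub hB (B1_horner (q (n.+1 * k)%N)).
  - exact: hlim.
  - exact: (B1_bounded (B1_horner x)).
have euQ : QpN (e u) by have /B1P[em _ _ _] := eB; apply: em.
have eul := B1_bounded eB l0 hu hul.
apply/eqP; rewrite -subr_eq0; apply/eqP.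
apply: (@absv_small0 _ (absv l)); first exact: absv_gt0.
move=> k; have bB := B1_horner (b k); have /B1P[bm bl bn _] := bB.
have buQ := bm _ hu.
have <- : absv (p%:R ^+ k * l) = r ^+ k * absv l by rewrite absvM absv_pX.
(* With [b = b k], the path from [e (e u)] to [e u] runs through [b (e u)], [b (b u)] and [b u];
   each of the four differences is at most [r^k |l|], the third because [b^2 - b] is a multiple of
   [z^((n+1) k)]. *)
rewrite -[_ - _](subrKA (horner_op (b k) u i)).
apply: absvD_le; last by rewrite absv_distC absvM absv_pX; apply: approx.
rewrite -[_ - _](subrKA (horner_op (b k) (horner_op (b k) u) i)).
apply: absvD_le.
  rewrite -[_ - _](subrKA (horner_op (b k) (e u) i)).
  apply: absvD_le; first by rewrite absvM absv_pX; apply: approx.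
  rewrite -lin_sub //; apply: B1_bounded => //.
  - by rewrite mulf_neq0 // expf_neq0 // p_neq0.
  - exact: QpN_sub.
  - by move=> i'; rewrite absvM absv_pX; apply: approx.
rewrite -horner_opM // -[_ - _]/(op_add _ (op_opp (horner_op (b k))) u i).
rewrite -horner_opN -horner_opD -expr2 idem_defectE.
have [s [_ [-> _]]] := idem_defect_iter ('X : {poly int}) q0 (n.+1 * k).
rewrite mulrCA absvM absv_pX; apply: opnorm_le_bounded => //; last exact: hzk.
by have /B1P[] := B1_horner (z ^+ (n.+1 * k) * (x * s)).
Qed.

End PolynomialCalculus.
End PadicOperators.

(* An idempotent E of A / K_(1) is a class a + K_(1) with a in A and
   a^2 - a in K_(1); the conclusion gives an idempotent e in A with
   e - a in K_(1), i.e. e + K_(1) = E. *)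
Theorem theorem3p17 (p : nat) (R : realType) (K : fieldType) (absv : K -> R)
    (A : set (op K)) :
  prime p -> is_Qp p absv ->
  A `<=` B1 absv ->
  Zp_subalgebra absv A ->
  norm_closed absv A ->
  K1 absv `<=` A ->
  forall a : op K, A a ->
  K1 absv (op_add (op_mul a a) (op_opp a)) ->
  exists e : op K, [/\ A e,
    (forall xi, QpN absv xi -> forall i, e (e xi) i = e xi i)
    & K1 absv (op_add e (op_opp a))].
Proof.
move=> p_prime Qp AB [AD _ _] _ KA a Aa aK.
have [h hB he] := idempotent_correction p_prime Qp (AB _ Aa) aK.
have hK := K1_mul Qp hB aK.
exists (op_add a (op_mul h (op_add (op_mul a a) (op_opp a)))); split=> //.
  by apply: AD => //; apply: KA.
congr (K1 absv _): hK; apply/funext => u; apply/funext => i.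
by rewrite /op_add /op_opp /= addrAC subrr add0r.
Qed.
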